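(* Let $\gamma\ge 1$ be an integer, $d\ge 1$, and let $\mathbf n=(n_1,\dots,n_d)$ be a $d$-tuple of non-negative integers. Let $\psi:\mathbb D^d\to\mathbb C$ be analytic and not identically zero, and let $\varphi:\mathbb D^d\to\mathbb D^d$ be an analytic self-map of the form $\varphi(z_1,\dots,z_d)=(\varphi_1(z_1),\dots,\varphi_d(z_d))$ such that $D_{\mathbf n,\psi,\varphi}$ is bounded on $\mathcal H_\gamma(\mathbb D^d)$. Then $D_{\mathbf n,\psi,\varphi}$ is self-adjoint if and only if there is an analytic function $g:\mathbb D^d\to\mathbb C$ with $\psi(z)=g(z)\prod_{j=1}^d z_j^{n_j}$ such that, with $a=\overline{g(0,\dots,0)}$, for all $z\in\mathbb D^d$, $$\psi(z_1,\dots,z_d)=a\prod_{j=1}^d z_j^{n_j}\bigl(1-z_j\overline{\varphi_j(0)}\bigr)^{-\gamma-n_j}$$ and $$\varphi_t(z_t)=\varphi_t(0)+\bigl(1-z_t\overline{\varphi_t(0)}\bigr)^{-1}z_t\overline{\varphi_t'(0)}\quad\text{for } t=1,\dots,d.$$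
   Context: $\mathbb D$ is the open unit disk in $\mathbb C$ and $\mathbb D^d$ the polydisk. For a positive integer $\gamma$, $\mathcal H_\gamma(\mathbb D^d)$ is the reproducing kernel Hilbert space of holomorphic functions on $\mathbb D^d$ with kernel $K_w(z)=\prod_{j=1}^d(1-\overline{w_j}z_j)^{-\gamma}$. The weighted composition-differentiation operator is $D_{\mathbf n,\psi,\varphi}f(z)=\psi(z)\,(\partial^{\mathbf n}f)(\varphi(z))$, where $\partial^{\mathbf n}=\frac{\partial^{n_1+\cdots+n_d}}{\partial z_1^{n_1}\cdots\partial z_d^{n_d}}$. *)

(* Defs.v *)
From HB Require Import structures.
From mathcomp Require Import all_boot all_order all_algebra.
From mathcomp Require Import all_classical all_reals all_analysis.
From mathcomp Require Import complex.

Set Implicit Arguments.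
Unset Strict Implicit.
Unset Printing Implicit Defensive.

Import Order.TTheory GRing.Theory Num.Theory.
Import numFieldNormedType.Exports.
Local Open Scope classical_set_scope.
Local Open Scope ring_scope.

(* Packing R[i] as a numClosedFieldType is what lets the norm, topology and
   derivatives that MathComp-Analysis puts on every numFieldType be inferred. *)
Definition Cplx (R : realType) : numClosedFieldType := complex R.

Section HilbertFunctionSpaces.
Variables (R : realType) (X : Type).
Local Notation C := (Cplx R).

(* A function on D is represented by a total function on X, whose values
   outside D are irrelevant.  A Hilbert space of functions on D is given by the
   set H of (representatives of) its members and its inner product ip, linear
   in the first argument, which is meaningful only on members of H. *)
Variables (D : set X) (H : set (X -> C)) (ip : (X -> C) -> (X -> C) -> C).

Definition ip_norm (f : X -> C) : C := sqrtC (ip f f).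

Definition ip_complete : Prop :=
  forall u : nat -> X -> C, (forall k, H (u k)) ->
    (forall e : C, 0 < e -> exists N : nat, forall k l : nat,
       (N <= k)%N -> (N <= l)%N -> ip_norm (fun z => u k z - u l z) < e) ->
    exists2 f, H f &
      forall e : C, 0 < e -> exists N : nat, forall k : nat,
        (N <= k)%N -> ip_norm (fun z => u k z - f z) < e.

Record hilbert_function_space : Prop := HilbertFunctionSpace {
  hfs_ext : forall f g, H f -> (forall z, D z -> f z = g z) -> H g;
  hfs_zero : H (fun=> 0);
  hfs_lin : forall a f g, H f -> H g -> H (fun z => a * f z + g z);
  hfs_ipl : forall a f g h, H f -> H g -> H h ->
    ip (fun z => a * f z + g z) h = a * ip f h + ip g h;
  hfs_ipC : forall f g, H f -> H g -> ip g f = (ip f g)^*;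
  hfs_ip_ge0 : forall f, H f -> 0 <= ip f f;
  hfs_ip_eq0 : forall f, H f -> (ip f f = 0 <-> forall z, D z -> f z = 0);
  hfs_complete : ip_complete }.

(* K w is the kernel function K_w, i.e. K w z = K_w(z). *)
Record RKHS (K : X -> X -> C) : Prop := MkRKHS {
  rkhs_hilbert : hilbert_function_space;
  rkhs_kernel : forall w, D w -> H (K w);
  rkhs_reproducing : forall f w, H f -> D w -> ip f (K w) = f w }.

Record bounded_linear_operator (T : (X -> C) -> (X -> C)) : Prop :=
  BoundedLinearOperator {
  blo_stable : forall f, H f -> H (T f);
  blo_linear : forall a f g, H f -> H g -> forall z, D z ->
    T (fun x => a * f x + g x) z = a * T f z + T g z;
  blo_bounded : exists M : C, forall f, H f -> ip_norm (T f) <= M * ip_norm f }.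

(* For an everywhere defined bounded operator, this is T = T^*. *)
Definition self_adjoint (T : (X -> C) -> (X -> C)) : Prop :=
  forall f g, H f -> H g -> ip (T f) g = ip f (T g).

End HilbertFunctionSpaces.

Section Polydisk.
Variables (R : realType) (d : nat).
Local Notation C := (Cplx R).

Definition unit_disk : set C := [set z | `|z| < 1].

Definition polydisk : set 'rV[C]_d := [set z | forall j, unit_disk (z 0 j)].

(* Differentiability is over the complex scalars: it is holomorphy. *)
Definition holomorphic_on (W : normedModType C) (D : set 'rV[C]_d)
    (f : 'rV[C]_d -> W) : Prop :=
  forall z, D z -> differentiable f z.

Definition partial (j : 'I_d) (f : 'rV[C]_d -> C) : 'rV[C]_d -> C :=
  fun z => 'D_(delta_mx 0 j) f z.

Definition partials (n : 'I_d -> nat) (f : 'rV[C]_d -> C) : 'rV[C]_d -> C :=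
  foldr (fun j => iter (n j) (partial j)) f (enum 'I_d).

Definition polydisk_kernel (gamma : nat) (w z : 'rV[C]_d) : C :=
  \prod_(j < d) (1 - (w 0 j)^* * z 0 j) ^- gamma.

(* (H, ip) is the reproducing kernel Hilbert space with kernel
   polydisk_kernel gamma; it is determined by its kernel, up to the values of
   functions outside the polydisk. *)
Definition is_H_gamma (gamma : nat) (H : set ('rV[C]_d -> C))
    (ip : ('rV[C]_d -> C) -> ('rV[C]_d -> C) -> C) : Prop :=
  RKHS polydisk H ip (polydisk_kernel gamma) /\
  forall f, H f -> holomorphic_on polydisk f.

Definition comp_diff (n : 'I_d -> nat) (psi : 'rV[C]_d -> C)
    (phi : 'rV[C]_d -> 'rV[C]_d) (f : 'rV[C]_d -> C) : 'rV[C]_d -> C :=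
  fun z => psi z * partials n f (phi z).

End Polydisk.

Arguments unit_disk R : clear implicits.
Arguments polydisk R d : clear implicits.

(* Main.v *)
Require Import Defs.
From HB Require Import structures.
From mathcomp Require Import all_boot all_order all_algebra.
From mathcomp Require Import all_classical all_reals all_analysis.
From mathcomp Require Import complex ring.

Import Order.TTheory GRing.Theory Num.Theory.
Import numFieldNormedType.Exports.
Local Open Scope classical_set_scope.
Local Open Scope ring_scope.

(* Write T for the operator.  Since <T K_w, K_z> = (T K_w)(z), self-adjointness
   forces (T K_w)(z) = conj ((T K_z)(w)), and conversely this identity between
   kernel functions is enough, because a bounded T has an adjoint T^* and both
   T^* and T are determined by their action on the kernels.

   As d^n K_w is an explicit product, the identity reads
     psi(z) conj(w)^n prod_j (1 - z_j conj(phi_j(w)))^(gamma + n_j)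
       = conj(psi(w)) z^n prod_j (1 - conj(w_j) phi_j(z))^(gamma + n_j).
   Fixing one w with nonzero coordinates exhibits z^n as a factor of psi, say
   psi = g z^n; the monomials then cancel, first where they do not vanish and
   then everywhere by continuity.  At w = 0 this gives psi, and differentiating
   along the t-th axis at w = 0 gives phi_t. *)

Set Implicit Arguments.
Unset Strict Implicit.

(** * Order and infima in the complex numbers *)

Section ComplexNumbers.
Context {R : realType}.
Local Notation C := (Cplx R).

(** The order on [C] is partial, so the Archimedean property is imported from [R]: a positive
    complex number is the image of its real part. *)
Lemma exists_invn_lt (e : C) : 0 < e -> exists N : nat, N.+1%:R^-1 < e.
Proof.
move=> e0.
have er : (complex.Re e)%:C%C = e :> C by apply: RRe_real; apply: gtr0_real.
have e0' : 0 < complex.Re e.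
  by move: (e0); rewrite -er ltcR.
have [N] := ltr_add_invr e0'; rewrite add0r => hN.
by exists N; rewrite -er -(rmorph_nat (real_complex R)) -fmorphV ltcR.
Qed.

Lemma eq0_of_norm_le_invn (x c : C) : 0 <= c ->
  (forall N : nat, `|x| ^+ 2 <= c * N.+1%:R^-1) -> x = 0.
Proof.
move=> c0 h; apply/eqP; apply/negPn/negP => x0.
(* The divisor is [c + 1] because [c] may vanish. *)
have p : 0 < `|x| ^+ 2 / (c + 1).
  by rewrite divr_gt0 ?ltr_wpDl // exprn_gt0 // normr_gt0.
have [N hN] := exists_invn_lt p.
have := h N; apply/negP; rewrite lt_geF //.
apply: le_lt_trans (_ : (c + 1) * N.+1%:R^-1 < _).
  by rewrite ler_wpM2r ?lerDl // invr_ge0 ler0n.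
by rewrite mulrC -ltr_pdivlMr // ltr_wpDl.
Qed.

(** Half of the parallelogram identity; it keeps the estimates in terms of squared norms. *)
Lemma normD_sqr_le (a b : C) : `|a + b| ^+ 2 <= (`|a| ^+ 2 + `|b| ^+ 2) *+ 2.
Proof.
rewrite -subr_ge0.
have -> : (`|a| ^+ 2 + `|b| ^+ 2) *+ 2 - `|a + b| ^+ 2 = `|a - b| ^+ 2.
  by rewrite !normCK rmorphB rmorphD /=; ring.
by rewrite exprn_ge0.
Qed.

Lemma real_infimum (X : Type) (P : X -> Prop) (J : X -> C) (b : C) :
  (exists x, P x) -> (forall x, P x -> J x \is Num.real) ->
  (forall x, P x -> b <= J x) ->
  exists m : C, (forall x, P x -> m <= J x) /\
    forall e, 0 < e -> exists x, P x /\ J x < m + e.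
Proof.
move=> [x0 Px0] Jr bJ.
have JR x : P x -> (complex.Re (J x))%:C%C = J x :> C.
  by move=> /Jr; apply: RRe_real.
(* A complex number comparable with a real one is itself real. *)
have br : (complex.Re b)%:C%C = b :> C.
  apply: RRe_real; have /ler_real -> := bJ _ Px0; exact: Jr.
pose S : set R := [set r | exists2 x, P x & r = complex.Re (J x)].
have hS : has_inf S.
  split; first by exists (complex.Re (J x0)); exists x0.
  exists (complex.Re b) => _ [x Px ->].
  by have := bJ _ Px; rewrite -JR // -br lecR.
exists (inf S)%:C%C; split.
  move=> x Px; rewrite -JR // lecR; apply: ge_inf; first by case: hS.
  by exists x.
move=> e e0.
have er : (complex.Re e)%:C%C = e :> C by apply: RRe_real; apply: gtr0_real.
have e0' : 0 < complex.Re e by move: (e0); rewrite -er ltcR.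
have [_ [x Px ->] hx] := inf_adherent e0' hS.
by exists x; split => //; rewrite -JR // -er -rmorphD ltcR.
Qed.

End ComplexNumbers.

(** * Hilbert spaces of functions: Cauchy-Schwarz, Riesz representation, adjoints and kernels *)

Section InnerProduct.
Context {R : realType} {X : Type} {D : set X}.
Local Notation C := (Cplx R).
Context {H : set (X -> C)} {ip : (X -> C) -> (X -> C) -> C}.
Hypothesis HS : hilbert_function_space D H ip.

Local Notation mem_lin := (hfs_lin HS).

Lemma mem_sub f g : H f -> H g -> H (fun z => f z - g z).
Proof.
move=> Hf Hg; have := mem_lin (-1) Hg Hf.
by congr H; apply/funext => z; rewrite mulN1r addrC.
Qed.

Lemma ip_subl f g h : H f -> H g -> H h ->
  ip (fun z => f z - g z) h = ip f h - ip g h.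
Proof.
move=> Hf Hg Hh; have := hfs_ipl HS (-1) Hg Hf Hh.
rewrite mulN1r addrC => <-; congr ip.
by apply/funext => z; rewrite mulN1r addrC.
Qed.

Lemma ip_linr a f g h : H f -> H g -> H h ->
  ip h (fun z => a * f z + g z) = a^* * ip h f + ip h g.
Proof.
move=> Hf Hg Hh.
rewrite (hfs_ipC HS) //; last exact: mem_lin.
by rewrite (hfs_ipl HS) // rmorphD rmorphM /= -!(hfs_ipC HS).
Qed.

Lemma ip_subr f g h : H f -> H g -> H h ->
  ip h (fun z => f z - g z) = ip h f - ip h g.
Proof.
move=> Hf Hg Hh; rewrite (hfs_ipC HS) //; last exact: mem_sub.
by rewrite ip_subl // rmorphB /= -!(hfs_ipC HS).
Qed.

Lemma ip_quad t f g : H f -> H g ->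
  ip (fun z => t * g z + f z) (fun z => t * g z + f z) =
  ip f f + t * t^* * ip g g + t * ip g f + (t * ip g f)^*.
Proof.
move=> Hf Hg; have Hh := mem_lin t Hg Hf.
rewrite (hfs_ipl HS) // !ip_linr // rmorphM /= -(hfs_ipC HS) //.
ring.
Qed.

(** The vector [f - s x g] has nonnegative square norm for every [s >= 0]; the choice [s = 1 / G]
    gives the inequality. *)
Lemma cauchy_schwarz f g : H f -> H g -> `|ip f g| ^+ 2 <= ip f f * ip g g.
Proof.
move=> Hf Hg.
set F := ip f f; set G := ip g g; set x := ip f g.
have F0 : 0 <= F := hfs_ip_ge0 HS Hf.
have G0 : 0 <= G := hfs_ip_ge0 HS Hg.
have key (s : C) : 0 <= s ->
    0 <= F + s ^+ 2 * `|x| ^+ 2 * G - s * `|x| ^+ 2 *+ 2.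
  move=> s0; have := hfs_ip_ge0 HS (mem_lin (- s * x) Hg Hf).
  rewrite ip_quad // (hfs_ipC HS Hf Hg) // -/F -/G -/x normCK.
  rewrite !rmorphM /= conjCK rmorphN /= (CrealP (ger0_real s0)).
  by congr (0 <= _); ring.
have [x0|x0] := eqVneq (`|x| ^+ 2) 0; first by rewrite x0 mulr_ge0.
have xp : 0 < `|x| ^+ 2 by rewrite lt_neqAle eq_sym x0 exprn_ge0.
have [G00|Gn0] := eqVneq G 0.
  (* When [G = 0] the bound is linear in [s], and this [s] turns it into [0 <= F - 2 (F + 1)], which
     is absurd. *)
  have := key ((F + 1) / `|x| ^+ 2) (divr_ge0 (addr_ge0 F0 ler01) (ltW xp)).
  rewrite divfK // G00 mulr0 addr0.
  have -> : F - (F + 1) *+ 2 = - (F + 2) by ring.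
  by rewrite oppr_ge0 lt_geF // ltr_wpDl.
have Gp : 0 < G by rewrite lt_neqAle eq_sym Gn0 G0.
have := key G^-1; rewrite invr_ge0 => /(_ G0).
have -> : F + G^-1 ^+ 2 * `|x| ^+ 2 * G - G^-1 * `|x| ^+ 2 *+ 2 =
  F - `|x| ^+ 2 / G by field.
by rewrite subr_ge0 ler_pdivrMr.
Qed.

(** [ip] acts on representatives, so its independence of the values outside [D] needs an argument:
    [f - g] has norm zero, and Cauchy-Schwarz applies. *)
Lemma ip_eql f g h : H f -> H g -> H h -> (forall z, D z -> f z = g z) ->
  ip f h = ip g h.
Proof.
move=> Hf Hg Hh fg; apply/eqP; rewrite -subr_eq0 -ip_subl //.
have Hs := mem_sub Hf Hg.
have /(hfs_ip_eq0 HS Hs) s0 : forall z, D z -> f z - g z = 0.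
  by move=> z Dz; rewrite fg // subrr.
have := cauchy_schwarz Hs Hh; rewrite s0 mul0r => le0.
by rewrite -normr_eq0 -sqrf_eq0 eq_le le0 exprn_ge0.
Qed.

Theorem riesz_representation (L : (X -> C) -> C) (B : C) : 0 <= B ->
  (forall a f g, H f -> H g -> L (fun z => a * f z + g z) = a * L f + L g) ->
  (forall f, H f -> `|L f| ^+ 2 <= B * ip f f) ->
  exists2 g, H g & forall f, H f -> L f = ip f g.
Proof.
(* The representative minimizes J f = |f|^2 - 2 Re (L f): by the parallelogram
   law a minimizing sequence u is Cauchy, and its limit represents L. *)
move=> B0 Llin Lbd.
pose J f := ip f f - (L f + (L f)^*).
have Jquad t f g : H f -> H g -> J (fun z => t * g z + f z) =
    J f + t * t^* * ip g g + t * (ip g f - L g) + (t * (ip g f - L g))^*.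
  move=> Hf Hg; rewrite /J ip_quad // Llin //.
  by rewrite !(rmorphD, rmorphM, rmorphN) /=; ring.
have Jreal f : H f -> J f \is Num.real.
  move=> Hf; rewrite realB ?(ger0_real (hfs_ip_ge0 HS Hf)) //.
  by apply/CrealP; rewrite rmorphD /= conjCK addrC.
(* Expanding [|L f - (B + 1)|^2 >= 0] bounds [2 (B + 1) Re (L f)] by [B N + (B + 1)^2]; using
   [B + 1] instead of [B] allows the division. *)
have Jlb f : H f -> - (B + 1) <= J f.
  move=> Hf; set N := ip f f; have Bp : 0 < B + 1 by rewrite ltr_wpDl.
  have N0 : 0 <= N := hfs_ip_ge0 HS Hf.
  have : 0 <= `|L f - (B + 1)| ^+ 2 by rewrite exprn_ge0.
  rewrite normCK rmorphB /= (CrealP (gtr0_real Bp)).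
  have -> : (L f - (B + 1)) * ((L f)^* - (B + 1)) =
    `|L f| ^+ 2 + (B + 1) ^+ 2 - (B + 1) * (L f + (L f)^*).
    by rewrite normCK; ring.
  rewrite subr_ge0 => h.
  have {}h : (B + 1) * (L f + (L f)^*) <= (B + 1) * (N + (B + 1)).
    apply: le_trans h _; rewrite mulrDr expr2 lerD2r.
    by apply: le_trans (Lbd _ Hf) _; rewrite ler_wpM2r // lerDl.
  rewrite ler_pM2l // in h.
  by rewrite /J lerNl opprB lerBlDl.
have [m [mJ mapp]] :
    exists m : C, (forall f, H f -> m <= J f) /\
      forall e, 0 < e -> exists f, H f /\ J f < m + e.
  apply: real_infimum Jreal Jlb; exists (fun=> 0); exact: hfs_zero HS.
have epsp k : 0 < k.+1%:R^-1 :> C by rewrite invr_gt0 ltr0n.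
have /choice[u hu] k := mapp _ (epsp k).
have Hu k : H (u k) := (hu k).1.
have udist k l : ip (fun z => u k z - u l z) (fun z => u k z - u l z) <=
    (k.+1%:R^-1 + l.+1%:R^-1) *+ 2.
  have Hd := mem_sub (Hu k) (Hu l); set dd := fun z => _ in Hd *.
  have := Jquad 1 _ _ (Hu l) Hd.
  have -> : (fun z => 1 * dd z + u l z) = u k.
    by apply/funext => z; rewrite /dd mul1r subrK.
  rewrite conjC1 !mul1r => Jk.
  have := Jquad 2^-1 _ _ (Hu l) Hd.
  have := mJ _ (mem_lin 2^-1 Hd (Hu l)).
  move: (J (fun z => 2^-1 * dd z + u l z)) => Jm mJm.
  rewrite rmorphM fmorphV rmorph_nat => Jme.
  (* The parallelogram law for [J], in which the linear terms cancel. [Jm] is the value at the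
     midpoint of [u k] and [u l], hence at least [m]. *)
  have -> : ip dd dd = J (u k) *+ 2 + J (u l) *+ 2 - Jm *+ 4.
    by rewrite Jk Jme; field.
  have -> : (k.+1%:R^-1 + l.+1%:R^-1) *+ 2 =
    (m + k.+1%:R^-1) *+ 2 + (m + l.+1%:R^-1) *+ 2 - m *+ 4 :> C by ring.
  have huk j := ltW (hu j).2.
  by apply: lerD; [apply: lerD|rewrite lerN2]; rewrite lerMn2r ?huk ?mJm.
have [f Hf uf] : exists2 f, H f & forall e : C, 0 < e -> exists N : nat,
    forall k : nat, (N <= k)%N -> ip_norm ip (fun z => u k z - f z) < e.
  apply: (hfs_complete HS) => // e e0.
  have e2 : 0 < e ^+ 2 / 4 by rewrite divr_gt0 // exprn_gt0.
  have [N hN] := exists_invn_lt e2; exists N => k l Nk Nl.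
  have ep2 : e = sqrtC (e ^+ 2) by rewrite sqrCK // ltW.
  rewrite /ip_norm ep2 ltr_sqrtC ?qualifE/= ?exprn_ge0 ?(ltW e0) //; last first.
    by apply: (hfs_ip_ge0 HS); apply: mem_sub.
  apply: le_lt_trans (udist k l) _.
  have hk j : (N <= j)%N -> j.+1%:R^-1 < e ^+ 2 / 4.
    move=> Nj; apply: le_lt_trans hN.
    by rewrite lef_pV2 ?posrE ?ltr0n // ler_nat.
  have -> : e ^+ 2 = (e ^+ 2 / 4 + e ^+ 2 / 4) *+ 2 by field.
  by rewrite ltrMn2r /= ltrD ?hk.
exists f => // h Hh; apply/eqP; rewrite -subr_eq0; apply/eqP.
have h0 : 0 <= ip h h := hfs_ip_ge0 HS Hh.
have hp : 0 < ip h h + 1 by rewrite ltr_wpDl.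
(* The difference is split through [u k] into two terms whose squares are at most
   [(ip h h + 1) / (n + 1)]; [normD_sqr_le] then yields the factor 4. *)
apply: (eq0_of_norm_le_invn (c := (ip h h + 1) *+ 4)).
  by rewrite mulrn_wge0 // ltW.
move=> n.
have sp : 0 < sqrtC n.+1%:R^-1 :> C by rewrite sqrtC_gt0.
have [N hN] := uf _ sp.
(* [k >= n] puts [J (u k)] within [1 / (n + 1)] of [m], and [k >= N] puts [u k] within the square
   root of that of [f]. *)
pose k := maxn n N.
pose r := L h - ip h (u k).
(* Moving u k by a multiple of r^* in the direction h lowers J by a multiple of
   |r|^2, which cannot exceed the gap between J (u k) and the infimum m. *)
have hr : `|r| ^+ 2 <= (ip h h + 1) * n.+1%:R^-1.
  apply: le_trans (_ : (ip h h + 1) * k.+1%:R^-1 <= _); last first.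
    by rewrite ler_pM2l // lef_pV2 ?posrE ?ltr0n // ler_nat ltnS leq_maxl.
  pose s := (ip h h + 1)^-1.
  have s0 : 0 < s by rewrite invr_gt0.
  have := mJ _ (mem_lin (s * r^*) Hh (Hu k)); rewrite Jquad //.
  have -> : ip h (u k) - L h = - r by rewrite opprB.
  have -> : s * r^* * - r = - (s * `|r| ^+ 2) by rewrite normCK; ring.
  rewrite rmorphM /= conjCK (CrealP (gtr0_real s0)).
  have -> : s * r^* * (s * r) * ip h h = s * `|r| ^+ 2 * (s * ip h h).
    by rewrite normCK; ring.
  have sr0 : 0 <= s * `|r| ^+ 2 by rewrite mulr_ge0 ?exprn_ge0 // ltW.
  rewrite rmorphN /= (CrealP (ger0_real sr0)) => hm.
  have sh : s * ip h h <= 1 by rewrite mulrC ler_pdivrMr // mul1r lerDl.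
  have {}hm := le_trans hm (lerD (lerD (lerD (ltW (hu k).2)
    (ler_wpM2l sr0 sh)) (lexx _)) (lexx _)).
  have {}hm : s * `|r| ^+ 2 <= k.+1%:R^-1.
    rewrite -subr_ge0; move: hm; rewrite -subr_ge0; congr (0 <= _); ring.
  rewrite (_ : `|r| ^+ 2 = (ip h h + 1) * (s * `|r| ^+ 2)).
    by rewrite ler_pM2l.
  by rewrite mulVKf // gt_eqF.
have Hd := mem_sub (Hu k) Hf.
have hy : `|ip h (fun z => u k z - f z)| ^+ 2 <= (ip h h + 1) * n.+1%:R^-1.
  apply: le_trans (cauchy_schwarz Hh Hd) _.
  have := hN k (leq_maxr _ _).
  rewrite /ip_norm ltr_sqrtC ?qualifE/= ?invr_ge0 ?(hfs_ip_ge0 HS Hd) // => lt.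
  by rewrite ler_pM ?lerDl ?(hfs_ip_ge0 HS Hd) // ltW.
have -> : L h - ip h f = r + ip h (fun z => u k z - f z).
  by rewrite ip_subr // /r; ring.
apply: le_trans (normD_sqr_le _ _) _.
have -> : (ip h h + 1) *+ 4 * n.+1%:R^-1 =
  ((ip h h + 1) * n.+1%:R^-1 + (ip h h + 1) * n.+1%:R^-1) *+ 2 by ring.
by rewrite lerMn2r /= lerD.
Qed.

Variable T : (X -> C) -> (X -> C).
Hypothesis BT : bounded_linear_operator D H ip T.

Lemma adjoint_exists g : H g ->
  exists2 h, H h & forall f, H f -> ip (T f) g = ip f h.
Proof.
move=> Hg; have [M hM] := blo_bounded BT.
have HT := blo_stable BT.
apply: (riesz_representation (B := `|M| ^+ 2 * ip g g)).
- by rewrite mulr_ge0 ?exprn_ge0 // (hfs_ip_ge0 HS).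
- move=> a f1 f2 H1 H2; rewrite -(hfs_ipl HS) //; try exact: HT.
  (* [T] is linear only up to values outside [D], which [ip] does not see. *)
  apply: ip_eql => //; [exact/HT/mem_lin | by apply: mem_lin; apply: HT |].
  exact: blo_linear BT _ _ _ H1 H2.
- move=> f Hf; apply: le_trans (cauchy_schwarz (HT _ Hf) Hg) _.
  rewrite mulrAC ler_wpM2r ?(hfs_ip_ge0 HS) //.
  have := hM _ Hf; rewrite /ip_norm => h.
  have n0 : 0 <= sqrtC (ip (T f) (T f)).
    by rewrite sqrtC_ge0; apply/(hfs_ip_ge0 HS)/HT.
  rewrite -[X in X <= _]sqrtCK -[X in _ * X]sqrtCK.
  (* [M] may be any complex number, but [M * sqrtC (ip f f)] bounds a norm and is therefore
     nonnegative. *)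
  have -> : `|M| ^+ 2 * sqrtC (ip f f) ^+ 2 = (M * sqrtC (ip f f)) ^+ 2.
    rewrite -[M * _](ger0_norm (le_trans n0 h)) normrM exprMn.
    by rewrite [`|sqrtC _|]ger0_norm // sqrtC_ge0 (hfs_ip_ge0 HS).
  by rewrite lerXn2r ?qualifE/= ?(le_trans n0 h).
Qed.

(** The kernel identity says that [T^* K_w = T K_w] on [D], whence [TKadj]. Then [(T^* g)(z) = <T^*
    g, K_z> = <g, T K_z> = (T g)(z)] for every [g]. *)
Lemma self_adjoint_of_kernel (K : X -> X -> C) : RKHS D H ip K ->
  (forall w z, D w -> D z -> T (K w) z = (T (K z) w)^*) ->
  self_adjoint H ip T.
Proof.
move=> [_ HK rep] TK; have HT := blo_stable BT.
have TKadj f w : H f -> D w -> ip f (T (K w)) = T f w.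
  move=> Hf Dw; have Hw := HK _ Dw.
  have [h Hh Eh] := adjoint_exists Hw.
  rewrite -(rep _ _ (HT _ Hf) Dw) Eh //.
  rewrite (hfs_ipC HS (HT _ Hw) Hf) (hfs_ipC HS Hh Hf); congr (_^*).
  apply: (ip_eql (HT _ Hw) Hh Hf) => z Dz; rewrite TK //.
  have Hz := HK _ Dz.
  by rewrite -(rep _ _ Hh Dz) (hfs_ipC HS Hz Hh) -Eh // (rep _ _ (HT _ Hz) Dw).
move=> f g Hf Hg; have [h Hh Eh] := adjoint_exists Hg; rewrite Eh //.
rewrite (hfs_ipC HS Hh Hf) (hfs_ipC HS (HT _ Hg) Hf); congr (_^*).
apply: (ip_eql Hh (HT _ Hg) Hf) => z Dz.
have Hz := HK _ Dz.
rewrite -(rep h) // (hfs_ipC HS Hz Hh) -Eh // -(TKadj g) //.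
by rewrite (hfs_ipC HS (HT _ Hz) Hg).
Qed.

Lemma kernel_of_self_adjoint (K : X -> X -> C) : RKHS D H ip K ->
  self_adjoint H ip T ->
  forall w z, D w -> D z -> T (K w) z = (T (K z) w)^*.
Proof.
move=> [_ HK rep] TT w z Dw Dz; have HT := blo_stable BT.
have [Hw Hz] := (HK _ Dw, HK _ Dz).
rewrite -(rep _ _ (HT _ Hw) Dz) TT // (hfs_ipC HS (HT _ Hz) Hw).
by rewrite (rep _ _ (HT _ Hz) Dw).
Qed.

End InnerProduct.

(** * The unit disk and derivatives in one complex variable *)

Section OneVariable.
Context {R : realType}.
Local Notation C := (Cplx R).

Lemma unit_disk_nbhs (x : C) : unit_disk R x -> \forall y \near x, unit_disk R y.
Proof.
rewrite /unit_disk /= => x1.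
exact: (@cvgr_norm_lt C C C (nbhs x) (nbhs_filter x) id x cvg_id 1 x1).
Qed.

Lemma unit_disk0 : unit_disk R 0.
Proof. by rewrite /unit_disk /= normr0. Qed.

Lemma one_minus_neq0 (x y : C) : unit_disk R x -> unit_disk R y -> 1 - x^* * y != 0.
Proof.
rewrite /unit_disk /= => x1 y1; rewrite subr_eq0; apply/eqP => e.
have : `|x^* * y| < 1 by rewrite normrM norm_conjC mulr_ilt1.
by rewrite -e normr1 ltxx.
Qed.

Lemma one_minus_neq0C (x y : C) : unit_disk R x -> unit_disk R y -> 1 - y * x^* != 0.
Proof. by rewrite mulrC; apply: one_minus_neq0. Qed.

Lemma is_derive_affine (A B : C) (u : C -> C) (du : C) :
  is_derive (0 : C) (1 : C) u du ->
  is_derive (0 : C) (1 : C) (fun h : C => A - B * u h) (- (B * du)).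
Proof.
move=> hu; have -> : (fun h : C => A - B * u h) = cst A - (B *: u) by [].
by apply: is_derive_eq; rewrite sub0r.
Qed.

Lemma is_derive_affineXV (A B : C) (m : nat) : A != 0 ->
  is_derive (0 : C) (1 : C) (fun h : C => (A - B * h) ^- m)
    (m%:R * B * A ^- m.+1).
Proof.
move=> A0.
pose f : C -> C := fun h => A - B * h.
have df : is_derive (0 : C) (1 : C) f (- B).
  by rewrite -[B]mulr1; apply: is_derive_affine; apply: is_derive_id.
have f0 : f 0 = A by rewrite /f mulr0 subr0.
have dfm := is_deriveX m df.
have fm0 : (f ^+ m) 0 != 0 by rewrite !fctE f0 expf_neq0.
have -> : (fun h : C => (A - B * h) ^- m) = (fun h => ((f ^+ m) h)^-1).
  by apply/funext => h; rewrite !fctE.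
have dm : derivable (f ^+ m) 0 1 by case: dfm.
apply: DeriveDef; first exact: derivableV.
rewrite deriveV //.
have -> := @derive_val _ _ _ _ _ _ _ dfm; rewrite !fctE f0 /GRing.scale /=.
case: m {dfm fm0 dm} => [|m] /=; first by rewrite !mul0r mulr0.
rewrite !exprS; field.
by rewrite A0 expf_neq0.
Qed.

(* Used in place of an extraction of m-th roots. *)
Lemma is_derive_eq_of_expr_eq (F G : C -> C) (dF dG : C) (m : nat) : (0 < m)%N ->
  is_derive (0 : C) (1 : C) F dF -> is_derive (0 : C) (1 : C) G dG ->
  (\forall h \near (0 : C), F h ^+ m = G h ^+ m) -> F 0 = G 0 -> F 0 != 0 ->
  dF = dG.
Proof.
move=> m0 hF hG FG FG0 F0.
have /(near_eq_derive (1 : C)) : \forall h \near (0 : C), (F ^+ m) h = (G ^+ m) h.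
  by near=> h; rewrite !fctE; near: h.
have -> := @derive_val _ _ _ _ _ _ _ (is_deriveX m hF).
have -> := @derive_val _ _ _ _ _ _ _ (is_deriveX m hG).
(* Both derivatives now carry the same nonzero factor [m (F 0)^(m - 1)]. *)
rewrite -FG0; apply: mulfI; rewrite mulf_neq0 ?expf_neq0 //.
by rewrite pnatr_eq0 -lt0n.
Unshelve. all: by end_near. Qed.

End OneVariable.

(** * Topology of the polydisk *)

Section Polydisk.
Context {R : realType} {d : nat}.
Local Notation C := (Cplx R).
Local Notation V := 'rV[C]_d.
Local Notation D := (polydisk R d).
Implicit Types (z w : V).

Lemma line_differentiable (v z : V) (h : C) :
  differentiable (fun t : C => t *: v + z) h.
Proof.
apply: differentiableD; last exact: differentiable_cst.
by apply: differentiableZl.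
Qed.

Lemma line_cvg (v z : V) : t *: v + z @[t --> (0 : C)] --> z.
Proof.
rewrite -[X in _ --> X]add0r -[X in X + _](scale0r v).
exact: differentiable_continuous (line_differentiable v z 0).
Qed.

Lemma polydisk_nbhs z : D z -> \forall z' \near z, D z'.
Proof.
move=> Dz.
apply: (@filter_forall _ _ (fun j z' => unit_disk R (z' 0 j)) _ (nbhs_filter z)) => j.
have /= := @coord_continuous C 1 d 0 j z _ (unit_disk_nbhs (Dz j)).
exact.
Qed.

Lemma polydisk0 : D 0.
Proof. by move=> j; rewrite mxE; apply: unit_disk0. Qed.

Lemma polydisk_axis (x : C) (t : 'I_d) : unit_disk R x -> D (x *: delta_mx 0 t).
Proof.
move=> Dx j; rewrite !mxE eqxx /=; case: eqP => _; rewrite ?mulr1 ?mulr0 //.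
exact: unit_disk0.
Qed.

(** Points without zero coordinates are dense: a small nonzero shift of [z] along [(1, ..., 1)]
    makes every coordinate nonzero. *)
Lemma eq0_on_polydisk (f : V -> C) : (forall z, D z -> {for z, continuous f}) ->
  (forall z, D z -> (forall j, z 0 j != 0) -> f z = 0) ->
  forall z, D z -> f z = 0.
Proof.
move=> cf f0 z Dz.
pose p (t : C) : V := t *: const_mx 1 + z.
have cp : p t @[t --> 0^'] --> z by apply: cvg_within_filter; apply: line_cvg.
have cfp : f (p t) @[t --> 0^'] --> f z.
  by apply: cvg_comp cp (cf z Dz).
apply/esym; apply: (cvg_unique (@norm_hausdorff _ _) _ cfp).
have nz : \forall t \near (0 : C)^', forall j, (p t) 0 j != 0.
  apply: (@filter_forall _ _ (fun j t => (p t) 0 j != 0) _ (dnbhs_filter (0 : C))) => j.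
  have [zj0|zjn0] := eqVneq (z 0 j) 0.
    near=> t; rewrite !mxE mulr1 zj0 addr0; near: t.
    exact: nbhs_dnbhs_neq.
  near=> t; rewrite !mxE mulr1 addr_eq0; apply/eqP => tz.
  have : `|t| < `|z 0 j| by near: t; apply: dnbhs0_lt; rewrite normr_gt0.
  by rewrite tz normrN ltxx.
have np : \forall t \near (0 : C)^', D (p t) := cp _ (polydisk_nbhs Dz).
apply: cvg_near_cst; near=> t; apply: f0; first by near: t.
by move=> j; move: j; near: t.
Unshelve. all: by end_near. Qed.

End Polydisk.

(** * Partial derivatives of the kernel functions *)

Section KernelDerivatives.
Context {R : realType} {d : nat}.
Local Notation C := (Cplx R).
Local Notation V := 'rV[C]_d.
Local Notation D := (polydisk R d).
Implicit Types (z w : V) (n k : 'I_d -> nat).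

Definition rising_factorial (gamma k : nat) : nat := \prod_(i < k) (gamma + i).

(** The closed form of the partial derivative of [K_w] of multi-index [k]. *)
Definition derived_kernel (gamma : nat) k w z : C :=
  \prod_(j < d) ((rising_factorial gamma (k j))%:R * (w 0 j)^* ^+ k j *
                 (1 - (w 0 j)^* * z 0 j) ^- (gamma + k j)).

Lemma rising_factorial_gt0 gamma (m : nat) :
  (0 < gamma)%N -> (0 < rising_factorial gamma m)%N.
Proof. by move=> g0; apply: prodn_gt0 => i; rewrite addn_gt0 g0. Qed.

(** Agreement of [f] with the closed form on [D] suffices because [D] is open and derivatives are
    local; this lets the lemma be iterated. *)
Lemma partial_derived_kernel gamma k w (f : V -> C) (j : 'I_d) : D w ->
  (forall z, D z -> f z = derived_kernel gamma k w z) ->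
  forall z, D z ->
    partial j f z = derived_kernel gamma (fun i => (k i + (i == j))%N) w z.
Proof.
move=> Dw fE z Dz.
set b := (w 0 j)^*; set A := 1 - b * z 0 j.
have A0 : A != 0 := one_minus_neq0 (Dw j) (Dz j).
(* [c] collects the factors that are constant along the [j]-th direction, [r] the constant part of
   the [j]-th factor. *)
pose c : C := \prod_(i < d | i != j) ((rising_factorial gamma (k i))%:R *
  (w 0 i)^* ^+ k i * (1 - (w 0 i)^* * z 0 i) ^- (gamma + k i)).
pose r : C := (rising_factorial gamma (k j))%:R * b ^+ k j.
pose e : V := delta_mx 0 j.
have -> : partial j f z = 'D_1 (fun h : C => f (h *: e + z)) 0.
  rewrite /partial /derive.
  set g1 := fun h => h^-1 *: _; set g2 := fun h => h^-1 *: _.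
  suff -> : g1 = g2 by []; apply/funext => h; rewrite /g1 /g2 /=.
  by rewrite addr0 scale0r add0r [_%:A]mulr1.
have Dnear : \forall h \near (0 : C), D (h *: e + z).
  exact: line_cvg (polydisk_nbhs Dz).
have /(near_eq_derive (1 : C)) -> : \forall h \near (0 : C),
    f (h *: e + z) = (c * r) *: (A - b * h) ^- (gamma + k j).
  near=> h; rewrite fE; last by near: h.
  rewrite /derived_kernel (bigD1 j) //= [X in _ * X = _](_ : _ = c).
    rewrite !mxE !eqxx mulr1 /r /A -/b.
    have -> : 1 - b * (h + z 0 j) = 1 - b * z 0 j - b * h by ring.
    by rewrite /GRing.scale /=; ring.
  apply: eq_bigr => i /negPf ij.
  by rewrite !mxE ij andbF mulr0 add0r.
have dA := is_derive_affineXV b (gamma + k j) A0.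
have dcA := is_deriveZ (c * r) dA.
have -> := @derive_val _ _ _ _ _ _ _ dcA.
rewrite /derived_kernel (bigD1 j) //= [X in _ = _ * X](_ : _ = c); last first.
  by apply: eq_bigr => i /negPf ij; rewrite ij addn0.
rewrite eqxx addn1 addnS /rising_factorial big_ord_recr /= natrM.
rewrite /GRing.scale /= /r -/b -/A /rising_factorial [b ^+ _.+1]exprSr.
by move: (A ^- _) => A'; ring.
Unshelve. all: by end_near. Qed.

Lemma partials_derived_kernel gamma n w (f : V -> C) : D w ->
  (forall z, D z -> f z = polydisk_kernel gamma w z) ->
  forall z, D z -> partials n f z = derived_kernel gamma n w z.
Proof.
move=> Dw f0.
have iterE j m k (h : V -> C) :
    (forall z, D z -> h z = derived_kernel gamma k w z) -> forall z, D z ->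
    iter m (partial j) h z =
      derived_kernel gamma (fun i => (k i + (i == j) * m)%N) w z.
  move=> hE; elim: m => [|m IH] z Dz.
    rewrite /= hE //; apply: eq_bigr => i _.
    by rewrite muln0 addn0.
  rewrite iterS (partial_derived_kernel j Dw IH) //; apply: eq_bigr => i _.
  suff -> : (k i + (i == j) * m + (i == j) = k i + (i == j) * m.+1)%N by [].
  by rewrite -addnA [((i == j) * m + _)%N]addnC -mulnS.
(* Uniqueness of [s] ensures that each variable contributes its order only once. *)
have fold s : uniq s -> forall z, D z ->
    foldr (fun j => iter (n j) (partial j)) f s z =
      derived_kernel gamma (fun i => ((i \in s) * n i)%N) w z.
  elim: s => [_ z Dz|j s IH /= /andP[js us] z Dz].
    rewrite /= f0 // /polydisk_kernel; apply: eq_bigr => i _.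
    by rewrite mul0n /rising_factorial big_ord0 expr0 !mul1r addn0.
  rewrite (iterE _ _ _ _ (IH us)) //; apply: eq_bigr => i _.
  rewrite inE; case: eqP => [->|_] /=; last by rewrite mul0n addn0.
  by rewrite (negPf js) mul0n !mul1n.
move=> z Dz; rewrite /partials fold ?enum_uniq //; apply: eq_bigr => i _.
by rewrite mem_enum mul1n.
Qed.

End KernelDerivatives.

(** * The operator on kernel functions and the resulting Hermitian identity *)

Section CompositionDifferentiation.
Context {R : realType} {gamma d : nat} {n : 'I_d -> nat}.
Local Notation C := (Cplx R).
Local Notation V := 'rV[C]_d.
Local Notation D := (polydisk R d).
Context {psi : V -> C} {phi : V -> V} {phi_ : 'I_d -> C -> C}.
Hypothesis gamma_gt0 : (0 < gamma)%N.
Hypothesis phi_holo : holomorphic_on D phi.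
Hypothesis phi_stable : forall z, D z -> D (phi z).
Hypothesis phiE : forall z, D z -> forall j, phi z 0 j = phi_ j (z 0 j).
Implicit Types (z w : V).

Definition monomial z : C := \prod_(j < d) z 0 j ^+ n j.

Definition kernel_denom w z : C :=
  \prod_(j < d) (1 - (w 0 j)^* * phi z 0 j) ^+ (gamma + n j).

(** The conjugate of [kernel_denom z w], expanded so that holomorphy in [z] is visible. *)
Definition kernel_denom_conj w z : C :=
  \prod_(j < d) (1 - z 0 j * (phi w 0 j)^*) ^+ (gamma + n j).

Local Notation m := monomial.
Local Notation Q := kernel_denom.
Local Notation Qc := kernel_denom_conj.

Lemma conj_kernel_denom w z : (Q z w)^* = Qc w z.
Proof.
rewrite rmorph_prod; apply: eq_bigr => j _.
by rewrite rmorphXn rmorphB rmorph1 rmorphM /= conjCK.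
Qed.

Lemma kernel_denom_neq0 w z : D w -> D z -> Q w z != 0.
Proof.
move=> Dw Dz; apply/prodf_neq0 => j _; rewrite expf_neq0 //.
exact: one_minus_neq0 (Dw j) (phi_stable Dz j).
Qed.

Lemma kernel_denom_conj_neq0 w z : D w -> D z -> Qc w z != 0.
Proof. by move=> Dw Dz; rewrite -conj_kernel_denom conjC_eq0 kernel_denom_neq0. Qed.

Lemma monomial_neq0 z : (forall j, z 0 j != 0) -> m z != 0.
Proof. by move=> h; apply/prodf_neq0 => j _; rewrite expf_neq0. Qed.

Lemma differentiable_prod_affineX (A : 'I_d -> C) (u : 'I_d -> V -> C)
    (e : 'I_d -> nat) z : (forall j, differentiable (u j) z) ->
  differentiable (fun z => \prod_j (1 - A j * u j z) ^+ e j) z.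
Proof.
move=> du.
have seqd (s : seq 'I_d) :
    differentiable (fun z => \prod_(j <- s) (1 - A j * u j z) ^+ e j) z.
  elim: s => [|j s IH].
    rewrite (_ : (fun z => _) = cst 1); first exact: differentiable_cst.
    by apply/funext => x; rewrite big_nil.
  rewrite (_ : (fun z => _) = (fun z => (1 - A j * u j z)) ^+ e j *
    (fun z => \prod_(j <- s) (1 - A j * u j z) ^+ e j)); last first.
    by apply/funext => x; rewrite big_cons !fctE.
  apply: differentiableM IH; case: (e j) => [|k].
    by rewrite expr0; apply: differentiable_cst.
  apply: differentiableX.
  apply: differentiableB; first exact: differentiable_cst.
  exact: (@differentiableZ _ _ _ (u j) (A j)).
exact: seqd.
Qed.

Lemma kernel_denom_differentiable w z : D z -> differentiable (Q w) z.
Proof.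
move=> Dz; apply: (@differentiable_prod_affineX (fun j => (w 0 j)^*)
  (fun j z => phi z 0 j)) => j.
apply: (@differentiable_comp _ _ _ _ phi (fun v : V => v 0 j)).
  exact: phi_holo.
exact: differentiable_coord.
Qed.

Lemma kernel_denom_conj_differentiable w z : differentiable (Qc w) z.
Proof.
rewrite (_ : Qc w = fun z => \prod_j (1 - (phi w 0 j)^* * z 0 j) ^+ (gamma + n j)).
  apply: (@differentiable_prod_affineX (fun j => (phi w 0 j)^*)
    (fun j z => z 0 j)) => j.
  exact: differentiable_coord.
by apply/funext => x; apply: eq_bigr => j _; rewrite mulrC.
Qed.

Lemma comp_diff_kernel w z : D w -> D z ->
  comp_diff n psi phi (polydisk_kernel gamma w) z =
  (\prod_(j < d) rising_factorial gamma (n j))%:R * (psi z * (m w)^* / Q w z).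
Proof.
move=> Dw Dz; rewrite /comp_diff.
rewrite (partials_derived_kernel n Dw (fun _ _ => erefl) (phi_stable Dz)).
rewrite /derived_kernel !big_split /= prodfV natr_prod rmorph_prod.
under [X in (_ * X) / _]eq_bigr do rewrite -rmorphXn.
by rewrite /kernel_denom; ring.
Qed.

(** The rising factorials cancel, being positive for [gamma > 0], and the denominators can be
    cleared because they do not vanish on the polydisk. *)
Lemma comp_diff_kernel_hermitianP w z : D w -> D z ->
  comp_diff n psi phi (polydisk_kernel gamma w) z =
    (comp_diff n psi phi (polydisk_kernel gamma z) w)^* <->
  psi z * (m w)^* * Qc w z = (psi w)^* * m z * Q w z.
Proof.
move=> Dw Dz; rewrite !comp_diff_kernel // rmorphM rmorph_nat.
rewrite 2!rmorphM fmorphV /= conjCK conj_kernel_denom.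
have r0 : (\prod_(j < d) rising_factorial gamma (n j))%:R != 0 :> C.
  by rewrite pnatr_eq0 -lt0n; apply: prodn_gt0 => j; apply: rising_factorial_gt0.
have Qn := kernel_denom_neq0 Dw Dz; have Qcn := kernel_denom_conj_neq0 Dw Dz.
split=> [/(mulfI r0)/eqP|e]; first by rewrite eqr_div // => /eqP.
by congr (_ * _); apply/eqP; rewrite eqr_div // e.
Qed.

(** Only [phi] is assumed holomorphic; on the disk, [phi_ t] is the [t]-th coordinate of [phi] along
    the [t]-th axis. *)
Lemma phi_is_derive t :
  is_derive (0 : C) (1 : C) (phi_ t) (derive1 (phi_ t) 0).
Proof.
rewrite derive1E; apply: derivableP.
pose e : V := delta_mx 0 t.
apply: (@near_eq_derivable C C C (fun h : C => phi (h *: e + 0) 0 t) (phi_ t) 0 1).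
  near=> h; have Dh : unit_disk R h by near: h; apply/unit_disk_nbhs/unit_disk0.
  by rewrite addr0 phiE ?mxE ?eqxx ?mulr1 //; apply: polydisk_axis.
apply/derivable1_diffP.
apply: (@differentiable_comp _ _ _ _ (fun h : C => phi (h *: e + 0))
  (fun v : V => v 0 t)); last exact: differentiable_coord.
apply: (@differentiable_comp _ _ _ _ (fun h : C => h *: e + 0) phi).
  exact: line_differentiable.
by apply: phi_holo; rewrite scale0r addr0; apply: polydisk0.
Unshelve. all: by end_near. Qed.

Lemma phi0E j : phi 0 0 j = phi_ j 0.
Proof. by rewrite phiE ?mxE //; apply: polydisk0. Qed.

Lemma kernel_denom0 z : Q 0 z = 1.
Proof. by apply: big1 => j _; rewrite mxE conjC0 mul0r subr0 expr1n. Qed.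

Lemma kernel_denom_conj0 w : Qc w 0 = 1.
Proof. by apply: big1 => j _; rewrite mxE mul0r subr0 expr1n. Qed.

Section Axis.
Variables (t : 'I_d) (x y : C).
Hypotheses (Dx : unit_disk R x) (Dy : unit_disk R y).
Local Notation e := (delta_mx 0 t : V).

(** On the [t]-th axis all other factors equal 1, which isolates [phi_ t]. *)
Lemma kernel_denom_axis :
  Q (x *: e) (y *: e) = (1 - x^* * phi_ t y) ^+ (gamma + n t).
Proof.
rewrite /kernel_denom (bigD1 t) //= big1 ?mulr1.
  by rewrite phiE ?mxE ?eqxx ?mulr1 //; apply: polydisk_axis.
move=> j /negPf jt.
by rewrite [X in X^*]mxE [X in x * X]mxE jt andbF mulr0 conjC0 mul0r subr0 expr1n.
Qed.

Lemma kernel_denom_conj_axis :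
  Qc (x *: e) (y *: e) = (1 - y * (phi_ t x)^*) ^+ (gamma + n t).
Proof.
rewrite /kernel_denom_conj (bigD1 t) //= big1 ?mulr1.
  by rewrite phiE ?mxE ?eqxx ?mulr1 //; apply: polydisk_axis.
move=> j /negPf jt.
by rewrite [X in X * _]mxE [X in y * X]mxE jt andbF mulr0 mul0r subr0 expr1n.
Qed.

End Axis.

(** * From the Hermitian identity to the formulas for [psi] and [phi_ t] *)

Section Hermitian.
Hypothesis hermitian : forall w z, D w -> D z ->
  psi z * (m w)^* * Qc w z = (psi w)^* * m z * Q w z.

(** The Hermitian identity at [w = w0], solved for [psi z / m z]; this is the function [g] of the
    theorem. *)
Definition monomial_cofactor (w0 z : V) : C :=
  (psi w0)^* / (m w0)^* * (Q w0 z / Qc w0 z).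

Lemma holomorphic_monomial_cofactor w0 : D w0 ->
  holomorphic_on D (monomial_cofactor w0).
Proof.
move=> Dw0 z Dz.
rewrite (_ : monomial_cofactor w0 = ((psi w0)^* / (m w0)^*) *:
  (Q w0 * (fun z => (Qc w0 z)^-1))); last by apply/funext.
apply: differentiableZ; apply: differentiableM.
  exact: kernel_denom_differentiable.
apply: differentiableV; first exact: kernel_denom_conj_differentiable.
exact: kernel_denom_conj_neq0.
Qed.

Lemma monomial_cofactorE w0 z : D w0 -> (forall j, w0 0 j != 0) -> D z ->
  psi z = monomial_cofactor w0 z * m z.
Proof.
move=> Dw0 w00 Dz; rewrite /monomial_cofactor.
have m0 : (m w0)^* != 0 by rewrite conjC_eq0 monomial_neq0.
have q0 := kernel_denom_conj_neq0 Dw0 Dz.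
apply: (mulIf (mulf_neq0 m0 q0)); rewrite mulrA hermitian //.
by field; rewrite m0 q0.
Qed.

(** The monomials cancel when neither [w] nor [z] has a zero coordinate. Density removes the
    restriction on [z]; conjugation swaps the two variables, and density applies once more. *)
Lemma cofactor_hermitian (g : V -> C) : holomorphic_on D g ->
  (forall z, D z -> psi z = g z * m z) ->
  forall w z, D w -> D z -> g z * Qc w z = (g w)^* * Q w z.
Proof.
move=> hg gE.
have extend w : D w ->
    (forall z, D z -> (forall j, z 0 j != 0) ->
      g z * Qc w z = (g w)^* * Q w z) ->
    forall z, D z -> g z * Qc w z = (g w)^* * Q w z.
  move=> Dw h z Dz; apply/eqP; rewrite -subr_eq0; apply/eqP.
  apply: (@eq0_on_polydisk _ _ (g * Qc w - (g w)^* *: Q w)) Dz => {}z Dz.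
    apply: differentiable_continuous; apply: differentiableB.
      apply: differentiableM; first exact: hg.
      exact: kernel_denom_conj_differentiable.
    by apply: differentiableZ; apply: kernel_denom_differentiable.
  by move=> z0; apply/eqP; rewrite subr_eq0; apply/eqP; apply: h.
have half w z : D w -> D z -> (forall j, w 0 j != 0) ->
    g z * Qc w z = (g w)^* * Q w z.
  move=> Dw Dz w0; apply: extend => // {Dz}{}z Dz z0.
  have mz := monomial_neq0 z0.
  have mw : (m w)^* != 0 by rewrite conjC_eq0 monomial_neq0.
  apply: (mulIf (mulf_neq0 mz mw)).
  have := hermitian Dw Dz; rewrite !gE // rmorphM /= => e.
  transitivity (g z * m z * (m w)^* * Qc w z); first by ring.
  by rewrite e; ring.
move=> w z Dw Dz; apply: extend => // {Dz}{}z Dz z0.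
have /(congr1 (fun x => x^*)) := half z w Dz Dw z0.
rewrite !rmorphM /= conjCK -[Qc z w]conj_kernel_denom conjCK conj_kernel_denom.
by move=> <-.
Qed.

Lemma hermitian_formulas (g : V -> C) : (exists2 z, D z & psi z != 0) ->
  holomorphic_on D g -> (forall z, D z -> psi z = g z * m z) ->
  let a := (g 0)^* in
  forall z, D z ->
    psi z = a * \prod_(j < d)
      (z 0 j ^+ n j * (1 - z 0 j * (phi_ j 0)^*) ^- (gamma + n j)) /\
    forall t : 'I_d, phi_ t (z 0 t) = phi_ t 0 +
      (1 - z 0 t * (phi_ t 0)^*)^-1 * z 0 t * (derive1 (phi_ t) 0)^*.
Proof.
move=> [z1 Dz1 psiz1] hg gE /=; set a := (g 0)^*.
have gQ := cofactor_hermitian hg gE.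
have D0 := @polydisk0 R d.
have gz z : D z -> g z = a / Qc 0 z.
  move=> Dz; apply: (canRL (mulfK (kernel_denom_conj_neq0 D0 Dz))).
  by rewrite gQ // kernel_denom0 mulr1.
(* At [z = 0] the formula for [g] reads [g 0 = a], while [a] is the conjugate of [g 0]. *)
have aR : a^* = a by rewrite conjCK gz // kernel_denom_conj0 divr1.
have a0 : a != 0.
  apply: contraNneq psiz1 => a0.
  by rewrite gE // gz // a0 !mul0r.
move=> z Dz; split.
  rewrite gE // gz // big_split /= prodfV -/(m z).
  rewrite -mulrA [_^-1 * _]mulrC; congr (a * (_ * _^-1)).
  by apply: eq_bigr => j _; rewrite phi0E.
move=> t; set x := z 0 t; set c := phi_ t 0; set b := derive1 _ _.
have Dx : unit_disk R x := Dz t.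
have xc0 : 1 - x * c^* != 0.
  apply: one_minus_neq0C Dx; rewrite /c -phi0E.
  exact: phi_stable.
(* The identity for [g] at [w = h e_t], [z = x e_t], with [a] cancelled and everything conjugated so
   that both sides are holomorphic in [h]. *)
have key h : unit_disk R h ->
    ((1 - c^* * h) * (1 - x^* * phi_ t h)) ^+ (gamma + n t) =
    ((1 - x^* * c) * (1 - (phi_ t x)^* * h)) ^+ (gamma + n t).
  move=> Dh; pose e : V := delta_mx 0 t.
  have gaxis y : unit_disk R y ->
      g (y *: e) = a / (1 - y * c^*) ^+ (gamma + n t).
    move=> Dy; rewrite gz; last exact: polydisk_axis.
    rewrite -[X in Qc X _](scale0r e) kernel_denom_conj_axis //.
    exact: unit_disk0.
  have yc y : unit_disk R y -> (1 - y * c^*) ^+ (gamma + n t) != 0.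
    move=> Dy; rewrite expf_neq0 //; apply: one_minus_neq0C Dy.
    by rewrite /c -phi0E; apply: phi_stable.
  have := gQ _ _ (polydisk_axis t Dh) (polydisk_axis t Dx).
  rewrite !gaxis // kernel_denom_axis // kernel_denom_conj_axis //.
  have yh : ((1 - h * c^*) ^+ (gamma + n t))^* != 0 by rewrite conjC_eq0 yc.
  rewrite rmorphM fmorphV /= aR -!mulrA => /(mulfI a0).
  rewrite ![_^-1 * _]mulrC => /eqP; rewrite eqr_div ?yc // => /eqP.
  move=> /(congr1 (fun x => x^*)); rewrite -!exprMn.
  rewrite !(rmorphXn, rmorphM, rmorphB, rmorph1) /= !conjCK => e1.
  rewrite -!exprMn in e1; rewrite [c^* * h]mulrC [X in X ^+ _]mulrC e1.
  by rewrite [X in X ^+ _]mulrC [h * _]mulrC.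
have hphi := phi_is_derive t; rewrite -/b in hphi.
have hF := is_deriveM (is_derive_affine 1 (c^*) (@is_derive_id C C 0 1))
                      (is_derive_affine 1 (x^*) hphi).
have hG := is_deriveM (is_derive_cst (1 - x^* * c) (0 : C) (1 : C))
                      (is_derive_affine 1 ((phi_ t x)^*) (@is_derive_id C C 0 1)).
have m0 : (0 < gamma + n t)%N by rewrite addn_gt0 gamma_gt0.
(* The bases in [key] share the nonzero value [1 - x^* c] at [h = 0], so their derivatives there
   agree. Conjugated, this equation is linear in [phi_ t x]. *)
have dFG : (1 - c^* * 0) * - (x^* * b) + (1 - x^* * c) * - (c^* * 1) =
    (1 - x^* * c) * - ((phi_ t x)^* * 1) + (1 - (phi_ t x)^* * 0) * 0.
  apply: (is_derive_eq_of_expr_eq m0 hF hG).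
  - near=> h; apply: key; near: h.
    exact/unit_disk_nbhs/unit_disk0.
  - by rewrite !fctE !mulr0 !subr0 mul1r mulr1.
  - rewrite !fctE mulr0 subr0 mul1r -/c -conjC_eq0.
    by rewrite rmorphB rmorph1 rmorphM /= conjCK.
have {dFG} := congr1 (fun x => x^*) dFG.
rewrite !(rmorphM, rmorphD, rmorphB, rmorphN, rmorph1, rmorph0) /= !conjCK.
rewrite !mulr0 subr0 addr0 mul1r !mulr1 => e.
apply: (mulfI xc0); transitivity ((1 - x * c^*) * c + x * b^*); last by field.
by apply: oppr_inj; rewrite -[LHS]mulrN -e; ring.
Unshelve. all: by end_near. Qed.

End Hermitian.

(** The formulas force [a] and every [phi_t'(0)] to be real, and then the Hermitian identity can be
    checked one coordinate at a time. *)
Lemma formulas_hermitian (g : V -> C) : holomorphic_on D g ->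
  (forall z, D z -> psi z = g z * m z) ->
  (let a := (g 0)^* in
  forall z, D z ->
    psi z = a * \prod_(j < d)
      (z 0 j ^+ n j * (1 - z 0 j * (phi_ j 0)^*) ^- (gamma + n j)) /\
    forall t : 'I_d, phi_ t (z 0 t) = phi_ t 0 +
      (1 - z 0 t * (phi_ t 0)^*)^-1 * z 0 t * (derive1 (phi_ t) 0)^*) ->
  forall w z, D w -> D z ->
    psi z * (m w)^* * Qc w z = (psi w)^* * m z * Q w z.
Proof.
move=> hg gE /=; set a := (g 0)^* => F.
have D0 := @polydisk0 R d.
have psiE z : D z -> psi z = a * m z / Qc 0 z.
  move=> Dz; rewrite (F z Dz).1 big_split /= prodfV -mulrA -/(m z).
  congr (_ * (_ * _^-1)); apply: eq_bigr => j _; by rewrite phi0E.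
(* Cancelling the monomial in the two expressions of [psi], with density where it vanishes, gives
   [g = a / Qc 0] on [D]; this is evaluated at 0. *)
have ga : g 0 = a.
  apply/eqP; rewrite -subr_eq0; apply/eqP.
  have := @eq0_on_polydisk _ _ (g - a *: (fun z => (Qc 0 z)^-1)) _ _ 0 D0.
  rewrite !fctE kernel_denom_conj0 invr1 [a *: _]mulr1; apply.
    move=> z Dz; apply: differentiable_continuous; apply: differentiableB.
      exact: hg.
    apply: differentiableZ; apply: differentiableV.
      exact: kernel_denom_conj_differentiable.
    exact: kernel_denom_conj_neq0.
  move=> z Dz z0; apply/eqP; rewrite subr_eq0; apply/eqP.
  apply: (mulIf (monomial_neq0 z0)); rewrite -gE // psiE //.
  by rewrite /GRing.scale /= mulrAC.
have aR : a^* = a by rewrite conjCK.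
(* Differentiating the formula for [phi_ t] at 0 gives the conjugate of [phi_t'(0)] on the right. *)
have bR t : (derive1 (phi_ t) 0)^* = derive1 (phi_ t) 0.
  pose c := phi_ t 0; pose b : C := derive1 (phi_ t) 0.
  have hG := is_deriveD (is_derive_cst c (0 : C) (1 : C))
    (is_deriveM (is_deriveM (is_derive_affineXV (c^*) 1 (oner_neq0 C))
      (@is_derive_id C C 0 1)) (is_derive_cst (b^*) (0 : C) (1 : C))).
  have nG : \forall h \near (0 : C),
     (cst c + (fun h : C => (1 - c^* * h) ^- 1) * id * cst (b^*)) h = phi_ t h.
    near=> h.
    have Dh : unit_disk R h by near: h; apply/unit_disk_nbhs/unit_disk0.
    have := (F _ (polydisk_axis t Dh)).2 t.
    rewrite !mxE !eqxx mulr1 => ->.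
    by rewrite !fctE expr1 [c^* * h]mulrC.
  have := @derive_val _ _ _ _ _ _ _ (phi_is_derive t).
  have -> := @derive_val _ _ _ _ _ _ _ (near_eq_is_derive nG hG).
  rewrite -/b; apply: etrans.
  rewrite scaler0 scale0r !add0r addr0 mulr0 subr0 expr1n invr1.
  by rewrite /GRing.scale /= !mulr1.
move=> w z Dw Dz.
suff QQ : Qc 0 z * Q w z = (Qc 0 w)^* * Qc w z.
  have q1 := kernel_denom_conj_neq0 D0 Dz.
  have q2 : (Qc 0 w)^* != 0 by rewrite conjC_eq0 kernel_denom_conj_neq0.
  rewrite !psiE // rmorphM fmorphV rmorphM /= aR.
  apply: (mulIf (mulf_neq0 q1 q2)).
  transitivity (a * m z * (m w)^* * ((Qc 0 w)^* * Qc w z)).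
    by field; rewrite q1.
  by rewrite -QQ; field; rewrite q2.
rewrite rmorph_prod -!big_split; apply: eq_bigr => j _ /=.
rewrite rmorphXn -!exprMn; congr (_ ^+ _).
rewrite rmorphB rmorph1 rmorphM /= conjCK phi0E !phiE // (F z Dz).2 (F w Dw).2.
have c1 : unit_disk R (phi_ j 0) by rewrite -phi0E; apply: phi_stable.
have z0 := one_minus_neq0C c1 (Dz j).
have w0 := one_minus_neq0 (Dw j) c1.
rewrite rmorphD !rmorphM fmorphV rmorphB rmorph1 rmorphM /= !conjCK !bR.
by field; rewrite z0 w0.
Unshelve. all: by end_near. Qed.

End CompositionDifferentiation.

(** * Equivalence of self-adjointness with the formulas *)

Unset Implicit Arguments.
Set Strict Implicit.

Theorem theorem2p6 (R : realType) (gamma d : nat) (n : 'I_d -> nat)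
    (H : set ('rV[Cplx R]_d -> Cplx R))
    (ip : ('rV[Cplx R]_d -> Cplx R) -> ('rV[Cplx R]_d -> Cplx R) -> Cplx R)
    (psi : 'rV[Cplx R]_d -> Cplx R)
    (phi : 'rV[Cplx R]_d -> 'rV[Cplx R]_d)
    (phi_ : 'I_d -> Cplx R -> Cplx R) :
  (0 < gamma)%N -> (0 < d)%N ->
  is_H_gamma gamma H ip ->
  holomorphic_on (polydisk R d) psi ->
  (exists2 z, polydisk R d z & psi z != 0) ->
  holomorphic_on (polydisk R d) phi ->
  (forall z, polydisk R d z -> polydisk R d (phi z)) ->
  (forall z, polydisk R d z -> forall j, phi z 0 j = phi_ j (z 0 j)) ->
  bounded_linear_operator (polydisk R d) H ip (comp_diff n psi phi) ->
  (self_adjoint H ip (comp_diff n psi phi) <->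
   exists g : 'rV[Cplx R]_d -> Cplx R,
     [/\ holomorphic_on (polydisk R d) g,
         forall z, polydisk R d z -> psi z = g z * \prod_(j < d) z 0 j ^+ n j
       & let a := (g 0)^* in
         forall z, polydisk R d z ->
           psi z = a * \prod_(j < d)
             (z 0 j ^+ n j * (1 - z 0 j * (phi_ j 0)^*) ^- (gamma + n j)) /\
           forall t : 'I_d,
             phi_ t (z 0 t) = phi_ t 0 +
               (1 - z 0 t * (phi_ t 0)^*)^-1 * z 0 t * (derive1 (phi_ t) 0)^*]).
Proof.
move=> gamma_gt0 _ [HK _] _ psi0 phi_holo phi_stable phiE bounded.
have HS := rkhs_hilbert HK.
have herm w z := comp_diff_kernel_hermitianP (n := n) (psi := psi) gamma_gt0
  phi_stable (w := w) (z := z).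
split=> [selfadj | [g [hg gE F]]].
  have hermitian w z (Dw : polydisk R d w) (Dz : polydisk R d z) :=
    (herm w z Dw Dz).1 (kernel_of_self_adjoint HS bounded HK selfadj Dw Dz).
  (* Any point of the polydisk without zero coordinates would serve to define the cofactor. *)
  pose w0 : 'rV[Cplx R]_d := const_mx 2^-1.
  have Dw0 : polydisk R d w0.
    move=> j; rewrite /unit_disk /= mxE ger0_norm ?invr_ge0 ?ler0n //.
    by rewrite invf_lt1 ?ltr0n // ltr1n.
  have w0n0 j : w0 0 j != 0 by rewrite mxE invr_eq0 pnatr_eq0.
  have hg := holomorphic_monomial_cofactor (gamma := gamma) (n := n)
    (psi := psi) phi_holo phi_stable Dw0.
  have gE z (Dz : polydisk R d z) :=
    monomial_cofactorE phi_stable hermitian Dw0 w0n0 Dz.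
  exists (monomial_cofactor (gamma := gamma) (n := n) (psi := psi) (phi := phi) w0).
  split=> //.
  exact: (hermitian_formulas gamma_gt0 phi_holo phi_stable phiE hermitian psi0
    hg gE).
apply: (self_adjoint_of_kernel HS bounded HK) => w z Dw Dz.
apply/herm => //.
exact: (formulas_hermitian phi_holo phi_stable phiE hg gE F).
Qed.
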